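(* Let $L\ge 3$, $W=(\mathbb{Z}/2\mathbb{Z})^{*L}$ with generating set $S$, $q\in(0,1]$, $h=\sum_{s\in S}T_s$ and $\mathbf{B}=\{h\}''\subseteq\mathrm{VN}_q(W)$ (the radial algebra). Then $\mathbf{B}$ is a maximal abelian von Neumann subalgebra of $\mathrm{VN}_q(W)$.
   Context: $W=(\mathbb{Z}/2\mathbb{Z})^{*L}$ is the free product of $L$ copies of $\mathbb{Z}/2\mathbb{Z}$; $S$ is the set of the $L$ canonical generators, $|\cdot|$ is word length with respect to $S$. Put $p=\frac{q-1}{q^2}$. $\mathbb{C}_q[W]$ is the $*$-algebra with linear basis $\{T_w: w\in W\}$, $T_e=1$, $T_w^*=T_{w^{-1}}$, and for $s\in S$, $w\in W$: $T_sT_w=T_{sw}$ if $|sw|>|w|$, $T_sT_w=T_{sw}+pT_w$ if $|sw|<|w|$. Identifying $T_w$ with $\delta_w\in\ell^2(W)$, left multiplication extends to bounded operators on $\ell^2(W)$, and $\mathrm{VN}_q(W)$ is the von Neumann algebra generated by them in $B(\ell^2(W))$. *)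

(* Defs.v *)
From HB Require Import structures.
From mathcomp Require Import all_boot all_order all_algebra.
From mathcomp Require Import all_classical all_reals all_analysis.
From mathcomp Require Import complex.
Set Implicit Arguments. Unset Strict Implicit. Unset Printing Implicit Defensive.
Import Order.TTheory GRing.Theory Num.Theory.
Local Open Scope ring_scope.

(* An element of W is a reduced word s_1 ... s_k over the L generators,
   i.e. no two consecutive letters are equal (normal form in the free product). *)
Definition reducedb (L : nat) (w : seq 'I_L) : bool := sorted (fun a b => a != b) w.

Definition Wgrp (L : nat) := {w : seq 'I_L | reducedb w}.

Definition wlen (L : nat) (w : Wgrp L) : nat := size (val w).

Definition smul_seq (L : nat) (s : 'I_L) (w : seq 'I_L) : seq 'I_L :=
  if ohead w == Some s then behead w else s :: w.

Lemma smul_seq_reduced (L : nat) (s : 'I_L) (w : seq 'I_L) :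
  reducedb w -> reducedb (smul_seq s w).
Proof.
rewrite /reducedb /smul_seq; case: w => [|a w] //= Hw.
case: eqP => [_|Hne]; first exact: path_sorted Hw.
rewrite /= Hw andbT; apply/eqP => Hsa; apply: Hne; by rewrite Hsa.
Qed.

Definition smul (L : nat) (s : 'I_L) (w : Wgrp L) : Wgrp L :=
  exist _ (smul_seq s (val w)) (smul_seq_reduced s (valP w)).

Definition cabs2 (R : realType) (z : R[i]) : R := (@complex.Re R z) ^+ 2 + (@complex.Im R z) ^+ 2.

Definition norm2sq (R : realType) (L : nat) (f : Wgrp L -> R[i]) : \bar R :=
  \esum_(w in [set: Wgrp L]) (cabs2 (f w))%:E.

Definition l2 (R : realType) (L : nat) (f : Wgrp L -> R[i]) : Prop :=
  (norm2sq f < +oo)%E.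

(* Operators are functions on C^W; only their restriction to l^2(W) matters. *)
Definition op (R : realType) (L : nat) := (Wgrp L -> R[i]) -> (Wgrp L -> R[i]).

Definition bounded_op (R : realType) (L : nat) (A : op R L) : Prop :=
  (forall (a : R[i]) (f g : Wgrp L -> R[i]), l2 f -> l2 g ->
     A (fun w => a * f w + g w) = (fun w => a * A f w + A g w)) /\
  exists c : R, forall f, l2 f -> (norm2sq (A f) <= c%:E * norm2sq f)%E.

Definition commute_op (R : realType) (L : nat) (A B : op R L) : Prop :=
  forall f, l2 f -> A (B f) = B (A f).

Definition commutant (R : realType) (L : nat) (S : set (op R L)) : set (op R L) :=
  [set x | bounded_op x /\ forall y, S y -> commute_op x y].

Definition bicommutant (R : realType) (L : nat) (S : set (op R L)) : set (op R L) :=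
  commutant (commutant S).

Definition hp (R : realType) (q : R) : R := (q - 1) / q ^+ 2.

(* T_s delta_w = delta_{sw} if |sw| > |w|,  delta_{sw} + p delta_w if |sw| < |w|,
   i.e. (T_s f)(v) = f(s v) + p [|s v| < |v|] f(v). *)
Definition Ts (R : realType) (L : nat) (q : R) (s : 'I_L) : op R L :=
  fun f v => f (smul s v) + (if (wlen (smul s v) < wlen v)%N then Complex (hp q) 0 else 0) * f v.

Definition hrad (R : realType) (L : nat) (q : R) : op R L :=
  fun f v => \sum_(s < L) Ts q s f v.

(* VN_q(W) = {T_s : s in S}'' (the T_s are self-adjoint, T_s^* = T_{s^{-1}} = T_s) *)
Definition VNq (R : realType) (L : nat) (q : R) : set (op R L) :=
  bicommutant [set Ts q s | s in [set: 'I_L]].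

Definition radial (R : realType) (L : nat) (q : R) : set (op R L) :=
  bicommutant [set hrad q].

Definition masa_in (R : realType) (L : nat) (B M : set (op R L)) : Prop :=
  (forall x, B x -> M x) /\
  (forall x y, B x -> B y -> commute_op x y) /\
  (forall x, M x -> (forall b, B b -> commute_op x b) -> B x).

(* Main.v *)
Require Import Defs.
From HB Require Import structures.
From mathcomp Require Import all_boot all_order all_algebra.
From mathcomp Require Import all_classical all_reals all_analysis.
From mathcomp Require Import complex finmap.
From mathcomp Require Import ring lra.
Set Implicit Arguments. Unset Strict Implicit. Unset Printing Implicit Defensive.
Import Order.TTheory GRing.Theory Num.Theory.
Local Open Scope ring_scope.

(* Let x in VN_q(W) commute with h and put xi = x delta_e. Since x commutes with
   right multiplications, h xi = xi h; the terms in p cancel from this equation,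
   leaving sum_s xi(sw) = sum_s xi(ws) for all w. Put k = L - 1 and sum this over
   all extensions of w by j letters on the right and i on the left. The defect
   between "i+1 left, j right" and "i left, j+1 right" letters is then
   multiplied by k when i and j both increase by one, whereas by Cauchy-Schwarz
   and square summability it is o(k^((i+j)/2)); so it vanishes, and this
   expresses xi(w) through the sum of xi over the right extensions of w minus its
   first letter, recursively through the sum over a whole sphere. Thus xi is
   radial, hence a limit of vectors b_n delta_e with b_n a polynomial in h.
   The matrix coefficients of z = x - b_n are
   (z delta_v)(w) = (T_{w^-1} (z delta_e))(v^-1), which bounds both z delta_v and
   the functionals f |-> (z f)(w) by a multiple of the norm of z delta_e, so
   that x inherits from the b_n the commutation with the commutant of h. *)

(** * Vectors on reduced words commuting with the radial element *)

(** The right side of the hypothesis is at most [(a * d + b * c)^2]. This controls the cross term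
    when Cauchy-Schwarz is proved one summand at a time. *)
Lemma ler_am_gm (R : realType) (y a b c d : R) :
  0 <= a -> 0 <= b -> 0 <= c -> 0 <= d ->
  y ^+ 2 <= 4 * (a * b) * (c * d) -> y <= a * d + b * c.
Proof.
move=> a0 b0 c0 d0 yy.
have ad : 0 <= a * d by exact: mulr_ge0.
have bc : 0 <= b * c by exact: mulr_ge0.
apply: (le_trans (ler_norm y)).
rewrite -(@ler_pXn2r R 2) ?nnegrE ?normr_ge0 ?addr_ge0 // real_normK ?num_real //.
have := sqr_ge0 (a * d - b * c); lra.
Qed.

Lemma sqr_sum_le (R : realType) (I : Type) (r : seq I) (P : pred I) (F : I -> R) :
  (\sum_(i <- r | P i) F i) ^+ 2 <=
  (\sum_(i <- r | P i) 1) * \sum_(i <- r | P i) F i ^+ 2.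
Proof.
have n0 s : 0 <= \sum_(i <- s | P i) (1 : R) by exact: sumr_ge0.
have F0 s : 0 <= \sum_(i <- s | P i) F i ^+ 2.
  by apply: sumr_ge0 => i _; exact: sqr_ge0.
elim: r => [|i r IH]; first by rewrite !big_nil expr0n mul0r.
rewrite !big_cons; case: ifP => // _.
move: IH (n0 r) (F0 r).
move: (\sum_(j <- r | P j) F j) (\sum_(j <- r | P j) 1) (\sum_(j <- r | P j) F j ^+ 2).
move=> S n T IH hn hT.
have : 2 * (F i * S) <= n * F i ^+ 2 + T * 1.
  apply: ler_am_gm => //; first exact: sqr_ge0.
  have := ler_wpM2l (sqr_ge0 (F i)) IH; lra.
lra.
Qed.

(** * Sums over one-letter extensions of reduced words *)

Section Extensions.
Variables (R : realType) (L : nat).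
Implicit Types (f g : seq 'I_L -> R) (w : seq 'I_L).

Definition left_ext f w : R := \sum_(s < L | ohead w != Some s) f (s :: w).
Definition right_ext f w : R := left_ext (f \o rev) (rev w).
Definition rbehead w : seq 'I_L := rev (behead (rev w)).

Lemma left_ext_cons f a w :
  left_ext f (a :: w) = \sum_(s < L | s != a) f (s :: a :: w).
Proof. by apply: eq_bigl => s; rewrite /= eq_sym. Qed.

Lemma right_ext_rcons f w b :
  right_ext f (rcons w b) = \sum_(s < L | s != b) f (rcons (rcons w b) s).
Proof.
rewrite /right_ext rev_rcons left_ext_cons; apply: eq_bigr => s _ /=.
by rewrite !rev_cons revK.
Qed.

Lemma reducedb_cons s w : reducedb (s :: w) = (ohead w != Some s) && reducedb w.
Proof. by case: w => [|a w] //=; rewrite /reducedb /= eq_sym. Qed.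

Lemma reducedb_rev w : reducedb (rev w) = reducedb w.
Proof.
by rewrite /reducedb rev_sorted; apply: eq_sorted => a b; rewrite eq_sym.
Qed.

(** Lets an identity that holds only on long enough words be summed over extensions. Below, [n] is 0
    or 1, which excludes the empty word or the words with at most one letter. *)
Lemma eq_left_ext f g n w :
  (forall v, reducedb v -> (n < size v)%N -> f v = g v) ->
  reducedb w -> (n <= size w)%N -> left_ext f w = left_ext g w.
Proof.
move=> fg rw nw; apply: eq_bigr => s sw.
by apply: fg => //; rewrite reducedb_cons sw rw.
Qed.

Lemma eq_right_ext f g n w :
  (forall v, reducedb v -> (n < size v)%N -> f v = g v) ->
  reducedb w -> (n <= size w)%N -> right_ext f w = right_ext g w.
Proof.
move=> fg rw nw; apply: (@eq_left_ext _ _ n) => [v rv nv|//|] /=.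
- by rewrite fg ?reducedb_rev ?size_rev.
- by rewrite reducedb_rev.
- by rewrite size_rev.
Qed.

Lemma left_extD f g w : left_ext (f \+ g) w = left_ext f w + left_ext g w.
Proof. by rewrite /left_ext big_split. Qed.
Lemma left_extB f g w : left_ext (fun v => f v - g v) w = left_ext f w - left_ext g w.
Proof. by rewrite /left_ext sumrB. Qed.
Lemma left_extZ (a : R) f w : left_ext (fun v => a * f v) w = a * left_ext f w.
Proof. by rewrite /left_ext mulr_sumr. Qed.
Lemma right_extD f g w : right_ext (f \+ g) w = right_ext f w + right_ext g w.
Proof. exact: left_extD. Qed.
Lemma right_extZ (a : R) f w : right_ext (fun v => a * f v) w = a * right_ext f w.
Proof. exact: (left_extZ a (f \o rev)). Qed.

(** The first letter of [w] alone constrains the new left letter and the last one alone the new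
    right letter, so the two summations are independent. *)
Lemma left_right_extC f w : w != [::] ->
  left_ext (right_ext f) w = right_ext (left_ext f) w.
Proof.
case: (lastP w) => // {}w b _; rewrite right_ext_rcons.
transitivity (\sum_(s < L | ohead (rcons w b) != Some s)
   \sum_(t < L | t != b) f (s :: rcons (rcons w b) t)).
  by apply: eq_bigr => s _; rewrite -rcons_cons right_ext_rcons.
rewrite exchange_big; apply: eq_bigr => t _ /=.
by apply: eq_bigl => s; case: w.
Qed.

Lemma left_ext_behead f w : w != [::] ->
  left_ext (f \o behead) w = L.-1%:R * f w.
Proof.
case: w => // a w _; rewrite left_ext_cons /= sumr_const mulr_natl.
by rewrite cardC1 card_ord.
Qed.

Lemma right_ext_rbehead f w : w != [::] ->
  right_ext (f \o rbehead) w = L.-1%:R * f w.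
Proof.
move=> w0; have rw0 : rev w != [::] by rewrite -size_eq0 size_rev size_eq0.
have := left_ext_behead (f \o rev) rw0; rewrite /= revK => <-.
by rewrite /right_ext; apply: eq_bigr => s _; rewrite /= /rbehead revK.
Qed.

(** With two letters or more, removing the first one keeps the last, which decides the admissible
    right extensions. *)
Lemma right_ext_behead f w : (1 < size w)%N ->
  right_ext (f \o behead) w = right_ext f (behead w).
Proof.
case: w => // a w; case: (lastP w) => // {}w b _.
by rewrite -rcons_cons right_ext_rcons /= right_ext_rcons.
Qed.

Lemma left_ext_sqr f w : w != [::] ->
  left_ext f w ^+ 2 <= L.-1%:R * left_ext (fun v => f v ^+ 2) w.
Proof.
case: w => // a w _; rewrite !left_ext_cons.
apply: le_trans (sqr_sum_le _ _ _) _.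
by rewrite sumr_const cardC1 card_ord.
Qed.

Lemma right_ext_sqr f w : w != [::] ->
  right_ext f w ^+ 2 <= L.-1%:R * right_ext (fun v => f v ^+ 2) w.
Proof.
by move=> w0; apply: left_ext_sqr; rewrite -size_eq0 size_rev size_eq0.
Qed.

Definition sphere_sum (m : nat) f : R :=
  \sum_(t : m.-tuple 'I_L | reducedb t) f t.

Lemma sphere_sum_rev m f : sphere_sum m (f \o rev) = sphere_sum m f.
Proof.
rewrite /sphere_sum [RHS](reindex (fun t : m.-tuple 'I_L => rev_tuple t)) /=; last first.
  exists (fun t : m.-tuple 'I_L => rev_tuple t) => t _; apply/val_inj; exact: revK.
by apply: eq_bigl => t; rewrite reducedb_rev.
Qed.

Lemma sphere_sum_left_ext m f : sphere_sum m (left_ext f) = sphere_sum m.+1 f.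
Proof.
rewrite /sphere_sum /left_ext.
rewrite (exchange_big_dep predT) //= pair_big_dep /=.
rewrite [RHS](reindex (fun p : 'I_L * m.-tuple 'I_L => cons_tuple p.1 p.2)) /=; last first.
  exists (fun t : m.+1.-tuple 'I_L => (thead t, behead_tuple t)).
    by move=> [s t] _ /=; congr pair; apply/val_inj.
  by move=> t _; rewrite [RHS]tuple_eta; apply/val_inj.
apply: eq_bigl => p; rewrite andbC.
by rewrite -(reducedb_cons p.1 p.2).
Qed.

Lemma sphere_sum_right_ext m f : sphere_sum m (right_ext f) = sphere_sum m.+1 f.
Proof.
rewrite -(sphere_sum_rev m.+1) -sphere_sum_left_ext -sphere_sum_rev.
by apply: eq_bigr => t _; rewrite /right_ext /= revK.
Qed.

Lemma le_sphere_sum m f w : (forall v, 0 <= f v) -> reducedb w -> size w = m ->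
  f w <= sphere_sum m f.
Proof.
move=> f0 rw sw; have sw' : size w == m by apply/eqP.
rewrite /sphere_sum (bigD1 (Tuple sw')) //= lerDl; exact: sumr_ge0.
Qed.

Lemma left_ext_le f g w : w != [::] ->
  (forall v, v != [::] -> f v <= g v) -> left_ext f w <= left_ext g w.
Proof. by move=> w0 fg; apply: (@ler_sum R _ _ (fun s => ohead w != Some s)) => s _; exact: fg. Qed.

Lemma right_ext_le f g w : w != [::] ->
  (forall v, v != [::] -> f v <= g v) -> right_ext f w <= right_ext g w.
Proof.
move=> w0 fg; apply: left_ext_le => [|v v0]; last apply: fg.
  by rewrite -size_eq0 size_rev size_eq0.
by rewrite -size_eq0 size_rev size_eq0.
Qed.

(** Each one-letter Cauchy-Schwarz step costs a factor [c]. The operator [ext] is abstract so as to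
    cover [left_ext] and [right_ext] alike. *)
Lemma iter_ext_sqr (ext : (seq 'I_L -> R) -> seq 'I_L -> R) (c : R) :
  0 <= c ->
  (forall f w, w != [::] -> ext f w ^+ 2 <= c * ext (fun v => f v ^+ 2) w) ->
  (forall f g w, w != [::] ->
    (forall v, v != [::] -> f v <= g v) -> ext f w <= ext g w) ->
  (forall a f w, ext (fun v => a * f v) w = a * ext f w) ->
  forall i f w, w != [::] ->
  iter i ext f w ^+ 2 <= c ^+ i * iter i ext (fun v => f v ^+ 2) w.
Proof.
move=> c0 sq le Z; elim=> [|i IH] f w w0; first by rewrite expr0 mul1r.
rewrite !iterS; apply: le_trans (sq _ _ w0) _.
rewrite exprS -mulrA ler_wpM2l // -Z.
by apply: le => // v v0; exact: IH.
Qed.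

Lemma sphere_sum_iter_left m i f :
  sphere_sum m (iter i left_ext f) = sphere_sum (m + i) f.
Proof.
elim: i m => [|i IH] m; first by rewrite addn0.
by rewrite iterS sphere_sum_left_ext IH addSnnS.
Qed.

Lemma sphere_sum_iter_right m i f :
  sphere_sum m (iter i right_ext f) = sphere_sum (m + i) f.
Proof.
elim: i m => [|i IH] m; first by rewrite addn0.
by rewrite iterS sphere_sum_right_ext IH addSnnS.
Qed.

Lemma iter_left_ge0 i f w : (forall v, 0 <= f v) -> 0 <= iter i left_ext f w.
Proof.
move=> f0; elim: i w => //= i IH w.
by apply: sumr_ge0 => s _.
Qed.

(** Cauchy-Schwarz over the two-sided extensions of [w], counted by the power of [L.-1]. They are
    distinct words of one sphere, so the sum of squares is enlarged to that whole sphere. *)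
Lemma iter_left_right_sqr i j f w : w != [::] -> reducedb w ->
  iter i left_ext (iter j right_ext f) w ^+ 2 <=
  L.-1%:R ^+ (i + j) * sphere_sum (size w + i + j) (fun v => f v ^+ 2).
Proof.
move=> w0 rw; have k0 : 0 <= L.-1%:R :> R by [].
apply: (le_trans (iter_ext_sqr k0 left_ext_sqr left_ext_le left_extZ i _ w0)); rewrite exprD -mulrA ler_wpM2l ?exprn_ge0 //.
apply: (le_trans (le_sphere_sum _ rw erefl)).
  by move=> v; apply: iter_left_ge0 => u; exact: sqr_ge0.
rewrite sphere_sum_iter_left -(sphere_sum_iter_right (size w + i) j) /sphere_sum mulr_sumr.
apply: (@ler_sum R _ _ (fun t : (size w + i).-tuple 'I_L => reducedb t)) => t _.
apply: (iter_ext_sqr k0 right_ext_sqr right_ext_le right_extZ).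
by rewrite -size_eq0 size_tuple; case: w w0 {rw} t => //.
Qed.

End Extensions.

(** * Square-summable solutions of the commutation equation are radial *)

Section RadialRigidity.
Variables (R : realType) (L : nat) (f : seq 'I_L -> R).
Hypothesis L_gt1 : (1 < L)%N.
(** For nonempty [w], the products [sw] are [behead w] and the reduced left extensions of [w], so
    this is the equation between the sums of [f(sw)] and of [f(ws)]. *)
Hypothesis f_comm : forall w, reducedb w -> w != [::] ->
  f (behead w) + left_ext f w = f (rbehead w) + right_ext f w.
Hypothesis f_decay : forall e : R, 0 < e -> exists m0, forall m, (m0 <= m)%N ->
  sphere_sum m (fun v => f v ^+ 2) <= e.

Let k : R := L.-1%:R.
Let A j := iter j (@right_ext R L) f.
Let E j v := left_ext (A j) v - A j.+1 v.

Let k_gt0 : 0 < k.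
Proof. by rewrite ltr0n; case: L L_gt1 => [|[]]. Qed.

(** The equation [f_comm] summed over right extensions [j + 1] times. The first summation turns the
    term in [rbehead] into [k * f w]; later ones only raise the indices. *)
Lemma right_ext_comm j w : reducedb w -> w != [::] ->
  right_ext (A j \o behead) w + left_ext (A j.+1) w = k * A j w + A j.+2 w.
Proof.
elim: j w => [|j IH] w rw w0.
  have := @eq_right_ext _ _ ((f \o behead) \+ left_ext f)
            ((f \o @rbehead L) \+ right_ext f) 0%N w.
  rewrite !right_extD (right_ext_rbehead _ w0) -(left_right_extC _ w0).
  apply=> // v rv; rewrite lt0n size_eq0 => v0; exact: f_comm.
have := @eq_right_ext _ _ ((A j.+1 \o behead) \+ left_ext (A j.+1))
          ((fun v => k * A j v) \+ A j.+2) 1%N w.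
rewrite !right_extD right_extZ -(left_right_extC _ w0).
apply=> //; last by case: w w0 {rw}.
move=> v rv sv; have v0 : v != [::] by case: v sv {rv}.
by rewrite /= -IH // right_ext_behead.
Qed.

(** Sum [right_ext_comm] once over left extensions: the term in [behead] becomes [k * A j.+1 w], and
    regrouping produces a defect on both sides. *)
Lemma left_ext_defect j w : reducedb w -> w != [::] ->
  left_ext (E j.+1) w = k * E j w.
Proof.
move=> rw w0.
have H := @eq_left_ext _ _ ((A j.+1 \o behead) \+ left_ext (A j.+1))
          ((fun v => k * A j v) \+ A j.+2) 1%N w.
rewrite !left_extD left_extZ (left_ext_behead _ w0) -/k in H.
rewrite /E left_extB mulrBr.
suff -> : left_ext (left_ext (A j.+1)) w =
  k * left_ext (A j) w + left_ext (A j.+2) w - k * A j.+1 w by lra.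
apply/eqP; rewrite eq_sym subr_eq eq_sym addrC; apply/eqP.
apply: H => //; last by case: w w0 {rw}.
move=> v rv sv; have v0 : v != [::] by case: v sv {rv}.
by rewrite /= -right_ext_comm // right_ext_behead.
Qed.

Lemma iter_left_ext_defect i j w : reducedb w -> w != [::] ->
  iter i (@left_ext R L) (E (i + j)%N) w = k ^+ i * E j w.
Proof.
elim: i j w => [|i IH] j w rw w0; first by rewrite mul1r.
rewrite iterS exprSr -mulrA -left_ext_defect // -left_extZ.
apply: (@eq_left_ext _ _ _ _ 0%N) => // v rv.
rewrite lt0n size_eq0 => v0; rewrite -IH //.
by rewrite addSnnS.
Qed.

Lemma iter_left_extB i (g h : seq 'I_L -> R) :
  iter i (@left_ext R L) (fun v => g v - h v) =
  (fun v => iter i (@left_ext R L) g v - iter i (@left_ext R L) h v).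
Proof.
elim: i => // i IH; rewrite !iterS IH; apply/funext => w; exact: left_extB.
Qed.

Lemma defect_eq0 j w : reducedb w -> w != [::] -> E j w = 0.
Proof.
move=> rw w0; apply/eqP; rewrite -sqrf_eq0; apply/eqP/le_anti.
rewrite sqr_ge0 andbT; apply/ler_addgt0Pl => e e0; rewrite addr0.
(* After [m0] steps the defect is a difference [x - y], with [(x - y)^2 <= 2 x^2 + 2 y^2], which
   accounts for the 4. Both [x^2] and [y^2] are bounded by [k^(2 m0 + j + 1)] times a sphere sum,
   hence the factor [k^(j+1)] in excess of [k^(2 m0)]. *)
have c0 : 0 < 4 * k ^+ j.+1 by rewrite mulr_gt0 ?exprn_gt0.
have [m0 Hm] := f_decay (divr_gt0 e0 c0).
have kp : 0 < k ^+ (m0 + m0) by exact: exprn_gt0.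
rewrite -(ler_pM2l kp).
have -> : k ^+ (m0 + m0) * E j w ^+ 2 = (k ^+ m0 * E j w) ^+ 2.
  by rewrite exprMn exprD expr2.
rewrite -iter_left_ext_defect // /E iter_left_extB -iterSr /=.
set x := left_ext _ _; set y := iter _ _ _ _.
have hx : x ^+ 2 <= k ^+ (m0 + m0) * k ^+ j.+1 * (e / (4 * k ^+ j.+1)).
  have := @iter_left_right_sqr R L m0.+1 (m0 + j) f w w0 rw.
  rewrite -/k iterS => /le_trans; apply.
  rewrite -exprD (_ : m0.+1 + (m0 + j) = m0 + m0 + j.+1)%N; last first.
    by rewrite addSn addnS addnA.
  rewrite ler_wpM2l ?exprn_ge0 ?(ltW k_gt0) //; apply: Hm.
  by rewrite -addnA addnCA (leq_trans (leqnSn _)) // addSn leq_addr.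
have hy : y ^+ 2 <= k ^+ (m0 + m0) * k ^+ j.+1 * (e / (4 * k ^+ j.+1)).
  have := @iter_left_right_sqr R L m0 (m0 + j).+1 f w w0 rw.
  rewrite -/k => /le_trans; apply.
  rewrite -exprD (_ : m0 + (m0 + j).+1 = m0 + m0 + j.+1)%N; last first.
    by rewrite !addnS addnA.
  rewrite ler_wpM2l ?exprn_ge0 ?(ltW k_gt0) //; apply: Hm.
  by rewrite -addnA addnCA leq_addr.
have -> : k ^+ (m0 + m0) * e =
  4 * (k ^+ (m0 + m0) * k ^+ j.+1 * (e / (4 * k ^+ j.+1))).
  field; exact: lt0r_neq0 (exprn_gt0 _ k_gt0).
have := sqr_ge0 (x + y); lra.
Qed.

(** All [j] are treated at once because the induction on [n] passes from [j] to [j + 1]. *)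
Lemma right_ext_sphere_constant n :
  forall j, exists c, forall w, reducedb w -> size w = n -> A j w = c.
Proof.
(* Vanishing of [E j.+1] cancels [left_ext (A j.+1)] against [A j.+2] in [right_ext_comm]. *)
have rec j w : reducedb w -> w != [::] ->
    k * A j w = right_ext (A j \o behead) w.
  move=> rw w0; have := right_ext_comm j rw w0.
  have := defect_eq0 j.+1 rw w0; rewrite /E /=; lra.
elim: n => [|[|n] IH] j.
- by exists (A j [::]) => w _ /size0nil ->.
(* Here [rec] equates [k * A j [:: s]] with the sum of [A j [:: t]] over [t != s]; adding [A j
   [:: s]] completes the sum, which no longer depends on [s]. *)
- exists ((\sum_(s < L) A j [:: s]) / (k + 1)) => -[|s [|]] // rw _.
  have := rec j [:: s] rw isT.
  rewrite -[X in right_ext _ X]/(rcons [::] s) right_ext_rcons /= => H.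
  have k1 : k + 1 != 0 by rewrite gt_eqF // ltr_wpDl // ltW.
  apply/eqP; rewrite eq_sym -(inj_eq (mulIf k1)) divfK //; apply/eqP.
  by rewrite (bigD1 s) //= -H; ring.
(* For longer words [rec] reads [k * A j w = A j.+1 (behead w)]. *)
- have [c Hc] := IH j.+1; exists (c / k) => w rw sw.
  have w0 : w != [::] by case: w sw {rw}.
  have k0 : k != 0 by exact: lt0r_neq0.
  rewrite -(Hc (behead w)); last first.
  + by rewrite size_behead sw.
  + by case: w rw {sw w0} => // a w /path_sorted.
  rewrite -[A j w](mulKf k0) (rec j w rw w0) right_ext_behead ?sw //.
  by rewrite mulrC.
Qed.

Lemma commuting_radial :
  exists c : nat -> R, forall w, reducedb w -> f w = c (size w).
Proof.
have [c Hc] := choice (fun n => right_ext_sphere_constant n 0%N).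
by exists c => w rw; exact: Hc.
Qed.

End RadialRigidity.

(** * Square-summable functions and bounded operators *)

Section SquareModulus.
Variable R : realType.
Implicit Types x y z : R[i].

Lemma ReD x y : complex.Re (x + y) = complex.Re x + complex.Re y.
Proof. by case: x; case: y. Qed.
Lemma ImD x y : complex.Im (x + y) = complex.Im x + complex.Im y.
Proof. by case: x; case: y. Qed.
Lemma ReM x y : complex.Re (x * y) =
  complex.Re x * complex.Re y - complex.Im x * complex.Im y.
Proof. by case: x; case: y. Qed.
Lemma ImM x y : complex.Im (x * y) =
  complex.Re x * complex.Im y + complex.Im x * complex.Re y.
Proof. by case: x; case: y. Qed.

Lemma cabs2_ge0 x : 0 <= cabs2 x.
Proof. by rewrite addr_ge0 ?sqr_ge0. Qed.

Lemma cabs2_0 : cabs2 (0 : R[i]) = 0.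
Proof. by rewrite /cabs2 /= expr0n addr0. Qed.

Lemma cabs2_1 : cabs2 (1 : R[i]) = 1.
Proof. by rewrite /cabs2 /= expr0n expr1n addr0. Qed.

Lemma cabs2_le0 x : cabs2 x <= 0 -> x = 0.
Proof.
case: x => a b; rewrite /cabs2 /= => h.
have a0 := sqr_ge0 a; have b0 := sqr_ge0 b.
have /eqP : a ^+ 2 = 0 by lra.
have /eqP : b ^+ 2 = 0 by lra.
by rewrite !sqrf_eq0 => /eqP -> /eqP ->.
Qed.

Lemma cabs2M x y : cabs2 (x * y) = cabs2 x * cabs2 y.
Proof. rewrite /cabs2 ReM ImM; ring. Qed.

Lemma cabs2D x y : cabs2 (x + y) <= 2 * cabs2 x + 2 * cabs2 y.
Proof.
rewrite /cabs2 ReD ImD.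
have := sqr_ge0 (complex.Re x - complex.Re y).
have := sqr_ge0 (complex.Im x - complex.Im y); lra.
Qed.

Lemma cabs2_sum_le (I : Type) (r : seq I) (F G : I -> R[i]) :
  cabs2 (\sum_(i <- r) F i * G i) <=
  (\sum_(i <- r) cabs2 (F i)) * \sum_(i <- r) cabs2 (G i).
Proof.
have s0 (H : I -> R[i]) s : 0 <= \sum_(i <- s) cabs2 (H i).
  by apply: sumr_ge0 => i _; exact: cabs2_ge0.
elim: r => [|i r IH]; first by rewrite !big_nil cabs2_0 mul0r.
rewrite !big_cons; move: IH (s0 F r) (s0 G r).
move: (\sum_(j <- r) F j * G j) (\sum_(j <- r) cabs2 (F j)).
move=> S A; move: (\sum_(j <- r) cabs2 (G j)) => B IH A0 B0.
set x := F i; set y := G i; pose z := x * y.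
have hz : cabs2 z = cabs2 x * cabs2 y by exact: cabs2M.
(* [d] is the real part of [S] times the conjugate of [z], the cross term in the squared modulus of
   [z + S]. *)
pose d := complex.Re z * complex.Re S + complex.Im z * complex.Im S.
have dd : d ^+ 2 <= cabs2 z * cabs2 S.
  have := sqr_ge0 (complex.Re z * complex.Im S - complex.Im z * complex.Re S).
  rewrite /d /cabs2; lra.
have : 2 * d <= cabs2 x * B + A * cabs2 y.
  apply: ler_am_gm; rewrite ?cabs2_ge0 //.
  have := ler_wpM2l (cabs2_ge0 z) IH; rewrite hz; rewrite hz in dd; lra.
have -> : cabs2 (x * y + S) = cabs2 z + cabs2 S + 2 * d.
  by rewrite /cabs2 /d -/z ReD ImD; ring.
rewrite hz; lra.
Qed.

End SquareModulus.

(** * Square-summable functions *)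

Section SquareSummable.
Variables (R : realType) (L : nat).
Local Notation W := (Wgrp L).
Local Notation fct := (W -> R[i]).
Implicit Types (f g : fct) (r e : R).

(** A bound on the squared norm through finite partial sums keeps all estimates in [R] instead of
    the extended reals. *)
Definition l2_le f r : Prop :=
  forall s : seq W, uniq s -> \sum_(w <- s) cabs2 (f w) <= r.

Lemma l2_leP f r : l2_le f r <-> (norm2sq f <= r%:E)%E.
Proof.
split=> [fr|fr s us].
  apply: ge_ereal_sup => _ [X [finX _] <-].
  rewrite fsbig_finite // sumEFin lee_fin; apply: fr; exact: fset_uniq.
have : (\esum_(w in [set: W]) (cabs2 (f w))%:E <= r%:E)%E by [].
rewrite -lee_fin -sumEFin; apply: le_trans.
apply: ereal_sup_ubound; exists [set` s]%classic; last by rewrite -fsbig_seq.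
by split=> //; exact: finite_seq.
Qed.

Lemma l2_le_ge0 f r : l2_le f r -> 0 <= r.
Proof. by move=> /(_ [::] isT); rewrite big_nil. Qed.

Lemma l2P f : l2 f <-> exists r, l2_le f r.
Proof.
split=> [f2|[r /l2_leP fr]]; last by rewrite /l2 (le_lt_trans fr) ?ltry.
have f0 : (0 <= norm2sq f)%E by apply: esum_ge0 => w _; rewrite lee_fin cabs2_ge0.
exists (fine (norm2sq f)); apply/l2_leP.
by rewrite fineK // ge0_fin_numE.
Qed.

Lemma l2_norm2sq f : l2 f -> exists2 r, norm2sq f = r%:E & l2_le f r.
Proof.
move=> f2.
have f0 : (0 <= norm2sq f)%E by apply: esum_ge0 => w _; rewrite lee_fin cabs2_ge0.
have E : norm2sq f = (fine (norm2sq f))%:E by rewrite fineK // ge0_fin_numE.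
by exists (fine (norm2sq f)) => //; apply/l2_leP; rewrite -E.
Qed.

Lemma l2_le_l2 f r : l2_le f r -> l2 f.
Proof. by move=> fr; apply/l2P; exists r. Qed.

Lemma l2_le_pw f g r : (forall w, cabs2 (g w) <= cabs2 (f w)) ->
  l2_le f r -> l2_le g r.
Proof.
move=> gf fr s us; apply: le_trans (fr s us); apply: (@ler_sum R) => w _; exact: gf.
Qed.

Lemma l2_le_trans f r r' : r <= r' -> l2_le f r -> l2_le f r'.
Proof. by move=> rr fr s us; exact: le_trans (fr s us) rr. Qed.

Lemma l2_leD f g r r' : l2_le f r -> l2_le g r' ->
  l2_le (fun w => f w + g w) (2 * r + 2 * r').
Proof.
move=> fr gr s us.
apply: le_trans (lerD (ler_wpM2l _ (fr s us)) (ler_wpM2l _ (gr s us))) => //.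
rewrite !mulr_sumr -big_split; apply: (@ler_sum R) => w _; exact: cabs2D.
Qed.

Lemma l2_leM (h : fct) c f r : 0 <= c -> (forall w, cabs2 (h w) <= c) ->
  l2_le f r -> l2_le (fun w => h w * f w) (c * r).
Proof.
move=> c0 hc fr s us.
apply: le_trans (ler_wpM2l c0 (fr s us)); rewrite mulr_sumr.
apply: (@ler_sum R) => w _; rewrite cabs2M.
by apply: ler_wpM2r; rewrite ?cabs2_ge0.
Qed.

Lemma l2_le_inj (phi : W -> W) f r : injective phi ->
  l2_le f r -> l2_le (f \o phi) r.
Proof.
move=> inj fr s us; rewrite -(big_map phi predT (fun w => cabs2 (f w))).
by apply: fr; rewrite map_inj_uniq.
Qed.

Lemma l2_le_at f r w : l2_le f r -> cabs2 (f w) <= r.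
Proof. by move=> /(_ [:: w] isT); rewrite big_seq1. Qed.

Lemma l2_lin (a : R[i]) f g : l2 f -> l2 g -> l2 (fun w => a * f w + g w).
Proof.
move=> /l2P[r fr] /l2P[r' gr].
have := l2_leD (l2_leM (h := fun=> a) (cabs2_ge0 a) (fun=> lexx _) fr) gr.
exact: l2_le_l2.
Qed.

Lemma l2_0 : l2 ((fun=> 0) : fct).
Proof.
apply/l2P; exists 0 => s _; rewrite big1 // => w _; exact: cabs2_0.
Qed.

Definition off (s : seq W) f : fct := fun w => if w \in s then 0 else f w.

(** Take [s] within [e] of the supremum of the finite partial sums: adjoining words outside [s]
    cannot exceed that supremum, so they contribute at most [e]. *)
Lemma l2_off f e : l2 f -> 0 < e -> exists2 s, uniq s & l2_le (off s f) e.
Proof.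
move=> /l2P[r fr] e0.
pose X : set R := [set x | exists2 s, uniq s & x = \sum_(w <- s) cabs2 (f w)]%classic.
have hX : has_sup X.
  split; first by exists 0, [::] => //; rewrite big_nil.
  by exists r => _ [s us ->]; exact: fr.
have [_ [s us ->] hs] := sup_adherent e0 hX.
exists s => // t ut.
have -> : \sum_(w <- t) cabs2 (off s f w) =
    \sum_(w <- [seq w <- t | w \notin s]) cabs2 (f w).
  rewrite big_filter (bigID (fun w => w \in s)) /= big1 ?add0r.
    by apply: eq_bigr => w; rewrite /off => /negPf ->.
  by move=> w ws; rewrite /off ws cabs2_0.
have := ub_le_sup hX.2 (x := \sum_(w <- s ++ [seq w <- t | w \notin s]) cabs2 (f w)).
rewrite big_cat /= => H.
have {}H := H (ex_intro2 _ _ (s ++ [seq w <- t | w \notin s]) _ (esym _)).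
have : \sum_(w <- s) cabs2 (f w) +
   \sum_(w <- [seq w <- t | w \notin s]) cabs2 (f w) <= sup X.
  apply: H; last by rewrite big_cat.
  rewrite cat_uniq us filter_uniq // andbT; apply/hasPn => w.
  by rewrite mem_filter => /andP[].
lra.
Qed.

Definition delta (v : W) : fct := fun w => (w == v)%:R.

Lemma l2_le_delta v : l2_le (delta v) 1.
Proof.
move=> s us; rewrite (eq_bigr (fun w => (w == v)%:R)); last first.
  by move=> w _; rewrite /delta; case: eqP => _; rewrite ?cabs2_1 ?cabs2_0.
rewrite -natr_sum -big_mkcond sum1_count -/(count_mem v s).
by rewrite count_uniq_mem // lern1 leq_b1.
Qed.

Definition fin_part (s : seq W) f : fct := fun w => \sum_(v <- s) f v * delta v w.

Lemma fin_partE s f w : uniq s -> f w = fin_part s f w + off s f w.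
Proof.
move=> us; rewrite /fin_part /off; case: ifPn => ws.
  rewrite (bigD1_seq w) //= /delta eqxx mulr1 big1 ?addr0 // => v vw.
  by rewrite eq_sym (negPf vw) mulr0.
rewrite big_seq big1 ?add0r // => v vs.
rewrite /delta; case: eqP => [wv|_]; last exact: mulr0.
by rewrite wv vs in ws.
Qed.

End SquareSummable.

(** * Bounded operators and commutants *)

Section Operators.
Variables (R : realType) (L : nat).
Local Notation W := (Wgrp L).
Local Notation fct := (W -> R[i]).
Implicit Types (f g : fct) (r e : R) (A B : op R L).

Definition lin_op A : Prop := forall (a : R[i]) f g, l2 f -> l2 g ->
  A (fun w => a * f w + g w) = (fun w => a * A f w + A g w).

Definition l2_le_op A (c : R) : Prop :=
  forall f r, l2_le f r -> l2_le (A f) (c * r).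

Lemma bounded_opP A : bounded_op A <-> lin_op A /\ exists2 c, 0 <= c & l2_le_op A c.
Proof.
split=> -[linA]; last first.
  move=> [c c0 Ac]; split=> //; exists c => f /l2_norm2sq[r -> fr].
  by rewrite -EFinM; apply/l2_leP; exact: Ac.
(* The constant supplied by [bounded_op] may be negative. *)
move=> [c Ac]; split=> //; exists (Num.max c 0); first by rewrite le_max lexx orbT.
move=> f r fr; have [r' E fr'] := l2_norm2sq (l2_le_l2 fr).
have := Ac f (l2_le_l2 fr); rewrite E -EFinM => /l2_leP; apply: l2_le_trans.
have rr : r' <= r by rewrite -lee_fin -E; apply/l2_leP.
have m0 : 0 <= Num.max c 0 by rewrite le_max lexx orbT.
apply: le_trans (ler_wpM2l m0 rr); apply: ler_wpM2r; first exact: l2_le_ge0 fr'.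
by rewrite le_max lexx.
Qed.

Lemma bounded_l2 A f : bounded_op A -> l2 f -> l2 (A f).
Proof.
by move=> /bounded_opP[_ [c _ Ac]] /l2P[r /Ac]; exact: l2_le_l2.
Qed.

Lemma bounded_id : bounded_op (id : op R L).
Proof.
by apply/bounded_opP; split=> //; exists 1 => // f r; rewrite mul1r.
Qed.

Lemma bounded_comp A B : bounded_op A -> bounded_op B -> bounded_op (A \o B).
Proof.
move=> bA bB; have /bounded_opP[lA [c c0 Ac]] := bA.
have /bounded_opP[lB [d d0 Bd]] := bB.
apply/bounded_opP; split=> [a f g f2 g2|] /=.
  by rewrite lB // lA //; exact: bounded_l2.
by exists (c * d); [exact: mulr_ge0|move=> f r fr; rewrite -mulrA; exact/Ac/Bd].
Qed.

Definition lin_comb (a : R[i]) A B : op R L := fun f w => a * A f w + B f w.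

Lemma bounded_lin_comb a A B :
  bounded_op A -> bounded_op B -> bounded_op (lin_comb a A B).
Proof.
move=> /bounded_opP[lA [c c0 Ac]] /bounded_opP[lB [d d0 Bd]].
apply/bounded_opP; split=> [b f g f2 g2|].
  by apply/funext => w; rewrite /lin_comb lA // lB //; ring.
exists (2 * (cabs2 a * c) + 2 * d).
  by rewrite addr_ge0 ?mulr_ge0 ?cabs2_ge0.
move=> f r fr.
have := l2_leD (l2_leM (h := fun=> a) (cabs2_ge0 a) (fun=> lexx _) (Ac _ _ fr)) (Bd _ _ fr).
apply: l2_le_trans; lra.
Qed.

Lemma bounded0 : bounded_op ((fun _ _ => 0) : op R L).
Proof.
apply/bounded_opP; split=> [a f g _ _|].
  by apply/funext => w; rewrite mulr0 addr0.
exists 0 => // f r _; rewrite mul0r => s _; rewrite big1 // => w _; exact: cabs2_0.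
Qed.

Lemma bounded_sum (I : Type) (s : seq I) (A : I -> op R L) :
  (forall i, bounded_op (A i)) -> bounded_op (fun f w => \sum_(i <- s) A i f w).
Proof.
move=> bA; elim: s => [|i s IH].
  rewrite (_ : (fun _ => _) = ((fun _ _ => 0) : op R L)); first exact: bounded0.
  by apply/funext => f; apply/funext => w; rewrite big_nil.
rewrite (_ : (fun _ => _) = lin_comb 1 (A i) (fun f w => \sum_(i <- s) A i f w)).
  exact: bounded_lin_comb.
by apply/funext => f; apply/funext => w; rewrite big_cons /lin_comb mul1r.
Qed.

Lemma lin_op0 A : lin_op A -> A (fun=> 0) = (fun=> 0).
Proof.
move=> lA; have := lA (-1) _ _ (@l2_0 R L) (@l2_0 R L).
rewrite (_ : (fun _ => _ * _ + _) = (fun=> 0)); last first.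
  by apply/funext => w; rewrite mulr0 addr0.
by move=> ->; apply/funext => w; rewrite mulN1r addNr.
Qed.

Lemma lin_op_sum A (I : Type) (s : seq I) (a : I -> R[i]) (F : I -> fct) :
  lin_op A -> (forall i, l2 (F i)) ->
  A (fun w => \sum_(i <- s) a i * F i w) = (fun w => \sum_(i <- s) a i * A (F i) w)
  /\ l2 (fun w => \sum_(i <- s) a i * F i w).
Proof.
move=> lA F2; elim: s => [|i s [IH IH2]].
  rewrite (_ : (fun _ => _) = (fun=> 0)); last by apply/funext => w; rewrite big_nil.
  split; last exact: l2_0.
  by rewrite lin_op0 //; apply/funext => w; rewrite big_nil.
rewrite (_ : (fun _ => _) = (fun w => a i * F i w + \sum_(i <- s) a i * F i w)); last first.
  by apply/funext => w; rewrite big_cons.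
split; last exact: l2_lin.
by rewrite lA // IH; apply/funext => w; rewrite big_cons.
Qed.

Lemma lin_op_fin_part A s f : lin_op A ->
  A (fin_part s f) = (fun w => \sum_(v <- s) f v * A (delta R v) w).
Proof.
move=> lA; have [] := @lin_op_sum A _ s f (fun v => delta R v) lA => //.
by move=> v; exact: l2_le_l2 (@l2_le_delta R L v).
Qed.

Lemma l2_fin_part s f : l2 (fin_part s f).
Proof.
have [] := @lin_op_sum id _ s f (fun v => delta R v) => //.
by move=> v; exact: l2_le_l2 (@l2_le_delta R L v).
Qed.

(** Reduces estimates of a coefficient of [A f] to finite combinations of the vectors [delta], where
    linearity applies. *)
Lemma bounded_op_at A f w e : bounded_op A -> l2 f -> 0 < e ->
  exists2 s, uniq s & cabs2 (A f w) <= 2 * cabs2 (A (fin_part s f) w) + e.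
Proof.
move=> /bounded_opP[lA [c c0 Ac]] f2 e0.
(* The tail outside [s] then contributes at most [2 * c * (e / (2 * c + 1)) <= e]; the added 1 keeps
   the denominator positive. *)
have d0 : 0 < e / (2 * c + 1) by rewrite divr_gt0 // ltr_wpDl // mulr_ge0.
have [s us hs] := l2_off f2 d0; exists s => //.
have {1}-> : f = (fun w => 1 * fin_part s f w + off s f w).
  by apply/funext => v; rewrite mul1r -fin_partE.
rewrite lA; [|exact: l2_fin_part|exact: l2_le_l2 hs].
rewrite mul1r; apply: le_trans (cabs2D _ _) _; rewrite lerD2l.
have := l2_le_at w (Ac _ _ hs) => H.
have H2 := ler_wpM2l (ler0n R 2) H; apply: le_trans H2 _.
have cp : 0 < 2 * c + 1 by rewrite ltr_wpDl // mulr_ge0.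
rewrite (_ : 2 * _ = e * (2 * c / (2 * c + 1))); last first.
  by field; exact: lt0r_neq0.
by rewrite ger_pMr // ler_pdivrMr // mul1r lerDl.
Qed.

Lemma bounded_op_eq0 A : bounded_op A -> (forall v, A (delta R v) = (fun=> 0)) ->
  forall f, l2 f -> A f = (fun=> 0).
Proof.
move=> bA A0 f f2; apply/funext => w; apply: cabs2_le0.
apply/ler_addgt0Pl => e e0; rewrite addr0.
have [s _] := bounded_op_at w bA f2 e0.
rewrite lin_op_fin_part; last by case: bA.
rewrite big1 ?cabs2_0 ?mulr0 ?add0r // => v _.
by rewrite A0 mulr0.
Qed.

Lemma commutant_lin_comb (S : set (op R L)) a x y :
  (forall z, S z -> bounded_op z) ->
  commutant S x -> commutant S y -> commutant S (lin_comb a x y).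
Proof.
move=> bS [bx cx] [by_ cy]; split; first exact: bounded_lin_comb.
move=> z Sz f f2; have [lz _] := bS z Sz.
rewrite /lin_comb lz; [|exact: bounded_l2|exact: bounded_l2].
by apply/funext => w; rewrite cx // cy.
Qed.

Lemma commutant_comp (S : set (op R L)) x y :
  (forall z, S z -> bounded_op z) ->
  commutant S x -> commutant S y -> commutant S (x \o y).
Proof.
move=> bS [bx cx] [by_ cy]; split; first exact: bounded_comp.
move=> z Sz f f2 /=; rewrite cy // cx //; exact: bounded_l2.
Qed.

End Operators.

(** * Left and right Hecke operators *)

Section Words.
Variable L : nat.
Local Notation W := (Wgrp L).
Implicit Types (w : seq 'I_L) (u v : W).

(** The generators are involutions, so the inverse of a word is its reversal. *)
Definition winv v : W :=
  exist _ (rev (val v)) (eq_trans (reducedb_rev (val v)) (valP v)).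

Definition wone : W := exist _ [::] isT.

Lemma winvK : involutive winv.
Proof. by move=> v; apply/val_inj; rewrite /= revK. Qed.

Lemma winv_inj : injective winv.
Proof. exact: inv_inj winvK. Qed.

Lemma smul_seq_cons s a w :
  smul_seq s (a :: w) = if a == s then w else s :: a :: w.
Proof. by []. Qed.

Lemma smulK s : involutive (@smul L s).
Proof.
move=> [w rw]; apply/val_inj; rewrite /=.
case: w rw => [|a w] rw; first by rewrite smul_seq_cons eqxx.
move: rw; rewrite reducedb_cons smul_seq_cons => /andP[aw _].
have [as_|as_] := eqVneq a s; last by rewrite smul_seq_cons eqxx.
by rewrite /smul_seq -as_ (negPf aw).
Qed.

Lemma wlen_smul_lt s v : (wlen (smul s v) < wlen v)%N = (ohead (val v) == Some s).
Proof.
case: v => -[|a w] rw; rewrite /wlen /= /smul_seq //=.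
by case: ifP => //= _; rewrite ?ltnS ?leqnn // ltnNge leqnSn.
Qed.

Definition rmul_seq w (t : 'I_L) := rev (smul_seq t (rev w)).

Lemma rmul_seq_rcons w b t :
  rmul_seq (rcons w b) t = if b == t then w else rcons (rcons w b) t.
Proof.
rewrite /rmul_seq rev_rcons smul_seq_cons.
by case: ifP => _; rewrite ?rev_cons revK.
Qed.

(** The two ends of a word interact only if it has at most one letter, whence the split into lengths
    0, 1 and at least 2. *)
Lemma smul_rmul_seqC s t w :
  rmul_seq (smul_seq s w) t = smul_seq s (rmul_seq w t).
Proof.
case: w => [|a w].
  rewrite [smul_seq s [::]]/= (rmul_seq_rcons [::]) /= smul_seq_cons eq_sym.
  by case: eqP => // ->.
case: (lastP w) => [|{}w b].
  rewrite smul_seq_cons (rmul_seq_rcons [::]) /=.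
  have [<-|as_] := eqVneq a s; have [at_|at_] := eqVneq a t.
  - by rewrite at_.
  - by rewrite smul_seq_cons eqxx.
  - by rewrite (rmul_seq_rcons [:: s]) at_ eqxx.
  - by rewrite (rmul_seq_rcons [:: s]) (negPf at_) smul_seq_cons (negPf as_).
rewrite smul_seq_cons -rcons_cons (rmul_seq_rcons (a :: w)).
have [as_|as_] := eqVneq a s; have [bt|bt] := eqVneq b t;
  rewrite /= smul_seq_cons ?as_ ?eqxx ?(negPf as_) -?rcons_cons rmul_seq_rcons;
  by rewrite ?bt ?eqxx ?(negPf bt).
Qed.

(* Left and right descents are independent, except when both multiplications
   yield the same word, where the two pairs of descents are exchanged. *)
Lemma smul_rmul_descent s t w :
  let ld (x : seq 'I_L) := ohead x == Some s in
  let rd (x : seq 'I_L) := ohead (rev x) == Some t in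
  (rd (smul_seq s w) = rd w /\ ld (rmul_seq w t) = ld w) \/
  [/\ smul_seq s w = rmul_seq w t, rd (smul_seq s w) = ld (rmul_seq w t)
    & ld w = rd w].
Proof.
case: w => [|a w] /=.
  have [->|st] := eqVneq s t; first by right.
  left; split; first exact: (negPf st).
  by rewrite eq_sym in st; exact: (negPf st).
case: (lastP w) => [|{}w b].
  rewrite smul_seq_cons (rmul_seq_rcons [::]) /=.
  have [<-|as_] := eqVneq a s; have [<-|at_] := eqVneq a t => /=.
  - by right.
  - by left; split=> //; symmetry; exact: (negPf at_).
  - by left; split=> //; symmetry; exact: (negPf as_).
  - by left.
left; rewrite smul_seq_cons -rcons_cons (rmul_seq_rcons (a :: w)).
split; last by case: ifP.
by case: ifP => _; rewrite -?rcons_cons !rev_rcons.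
Qed.

End Words.

(** * Left and right multiplication operators *)

Section Hecke.
Variables (R : realType) (L : nat) (q : R).
Local Notation W := (Wgrp L).
Local Notation fct := (W -> R[i]).
Local Notation delta := (@delta R L).
Local Notation one := (wone L).
Implicit Types (f g : fct) (r e : R) (A : op R L).

Definition flip f : fct := fun w => f (winv w).

Lemma flipK f : flip (flip f) = f.
Proof. by apply/funext => w; rewrite /flip winvK. Qed.

(** Right multiplication by [T_t]: inversion of words reverses products, so it exchanges left and
    right multiplication. *)
Definition rTs (t : 'I_L) : op R L := fun f => flip (Ts q t (flip f)).

Lemma bounded_flip : bounded_op flip.
Proof.
apply/bounded_opP; split=> //; exists 1 => // f r fr; rewrite mul1r.
exact: (l2_le_inj (@winv_inj L) fr).
Qed.

Lemma bounded_Ts s : bounded_op (@Ts R L q s).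
Proof.
apply/bounded_opP; split=> [a f g _ _|].
  by apply/funext => w; rewrite /Ts; ring.
exists (2 + 2 * (hp q) ^+ 2); first by rewrite addr_ge0 // mulr_ge0 // sqr_ge0.
move=> f r fr.
have H1 := l2_le_inj (inv_inj (@smulK L s)) fr.
rewrite mulrDl -mulrA; apply: l2_leD H1 (l2_leM (sqr_ge0 _) _ fr) => w.
case: ifP => _; last by rewrite cabs2_0 sqr_ge0.
by rewrite /cabs2 /= [0 ^+ 2]expr0n addr0.
Qed.

Lemma bounded_rTs t : bounded_op (rTs t).
Proof. exact: (bounded_comp bounded_flip (bounded_comp (bounded_Ts t) bounded_flip)). Qed.

Lemma bounded_hrad : bounded_op (@hrad R L q).
Proof. by apply: bounded_sum => s; exact: bounded_Ts. Qed.

(** In the generic case of [smul_rmul_descent] the terms in [p] agree one by one; in the exceptional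
    case [sw = wt] and the exchanged descents give the same sum. *)
Lemma Ts_rTsC s t f : Ts q s (rTs t f) = rTs t (Ts q s f).
Proof.
apply/funext => w; rewrite /rTs /flip /Ts !wlen_smul_lt !winvK /= -![sval w]/(val w).
set c := Complex _ _.
have assoc : winv (smul t (winv (smul s w))) = smul s (winv (smul t (winv w))).
  by apply/val_inj; exact: smul_rmul_seqC.
rewrite -assoc.
have [] := smul_rmul_descent s t (val w); rewrite /rmul_seq.
  move=> [-> ->]; case: (ohead (rev (val w)) == _); case: (ohead (val w) == _); ring.
move=> [E -> ->].
have -> : smul s w = winv (smul t (winv w)) by apply/val_inj; exact: E.
case: (ohead (rev (smul_seq _ _)) == _); case: (ohead (rev (val w)) == _); ring.
Qed.

Definition Tw (l : seq 'I_L) f : fct := foldr (fun s g => Ts q s g) f l.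
Definition rTw (l : seq 'I_L) f : fct := foldr (fun s g => rTs s g) f l.

Lemma rTwE l f : rTw l f = flip (Tw l (flip f)).
Proof. by elim: l => [|s l IH] /=; rewrite ?flipK // IH /rTs flipK. Qed.

Lemma Tw_rTwC l l' f : Tw l (rTw l' f) = rTw l' (Tw l f).
Proof.
have H s g : Ts q s (rTw l' g) = rTw l' (Ts q s g).
  by elim: l' => //= t l' <-; rewrite Ts_rTsC.
by elim: l => //= s l ->.
Qed.

Lemma bounded_Tw l : bounded_op (Tw l).
Proof.
elim: l => [|s l IH]; first exact: bounded_id.
exact: bounded_comp (bounded_Ts s) IH.
Qed.

Lemma bounded_rTw l : bounded_op (rTw l).
Proof.
elim: l => [|s l IH]; first exact: bounded_id.
exact: bounded_comp (bounded_rTs s) IH.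
Qed.

Lemma Ts_delta s v : ohead (val v) != Some s ->
  Ts q s (delta v) = delta (smul s v).
Proof.
move=> vs; apply/funext => w; rewrite /Ts /delta wlen_smul_lt.
rewrite -(inj_eq (inv_inj (@smulK L s)) (smul s w)) smulK.
have [->|_] := eqVneq w v; last by rewrite mulr0 addr0.
by rewrite (negPf vs) mul0r addr0.
Qed.

Lemma Tw_delta_one v : Tw (val v) (delta one) = delta v.
Proof.
case: v => l rl /=; elim: l rl => [|s l IH] rl /=.
  by congr delta; apply/val_inj.
have /andP[sl rl'] : (ohead l != Some s) && reducedb l by rewrite -reducedb_cons.
rewrite (IH rl') Ts_delta //; congr delta; apply/val_inj.
by rewrite /= /smul_seq (negPf sl).
Qed.

(** Every intermediate product is a suffix of the reduced word [v], so no descent occurs and no term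
    in [p] arises. *)
Lemma Tw_at l f w v : val v = rev l ++ val w -> Tw l f w = f v.
Proof.
elim: l w => [|s l IH] w /=.
  by move=> /val_inj ->.
rewrite rev_cons -cats1 -catA /= => Ev.
have : reducedb (s :: val w).
  have : reducedb (sval v) by exact: (valP v).
  rewrite Ev /reducedb.
  by move=> /cat_sorted2[].
rewrite reducedb_cons => /andP[sw _].
rewrite /Ts wlen_smul_lt (negPf sw) mul0r addr0; apply: IH.
by apply: (etrans Ev); rewrite /= /smul_seq (negPf sw).
Qed.

Lemma flip_delta v : flip (delta v) = delta (winv v).
Proof.
apply/funext => w; rewrite /flip /delta -(inj_eq (@winv_inj L)) winvK //.
Qed.

Lemma winv_one : winv one = one. Proof. exact/val_inj. Qed.

Lemma rTw_delta_one v : rTw (val v) (delta one) = delta (winv v).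
Proof. by rewrite rTwE flip_delta winv_one Tw_delta_one flip_delta. Qed.

Lemma Tw_at_one v f : Tw (val v) f one = f (winv v).
Proof. by apply: Tw_at; rewrite /= cats0. Qed.

Lemma rTw_at_one v f : rTw (val v) f one = f v.
Proof. by rewrite rTwE /flip winv_one Tw_at_one winvK. Qed.

Lemma l2_delta v : l2 (delta v).
Proof. exact: l2_le_l2 (@l2_le_delta R L v). Qed.

(** * Operators commuting with right multiplications *)

Section RightInvariant.
Variable z : op R L.
Hypothesis bz : bounded_op z.
Hypothesis zC : forall t, commute_op z (rTs t).

Lemma commute_rTw l f : l2 f -> z (rTw l f) = rTw l (z f).
Proof.
move=> f2; elim: l => //= t l <-; rewrite zC //; exact: bounded_l2 (bounded_rTw l) f2.
Qed.

Lemma right_invariant_delta v : z (delta v) = rTw (val (winv v)) (z (delta one)).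
Proof.
by rewrite -commute_rTw ?rTw_delta_one ?winvK //; exact: l2_delta.
Qed.

(** The value at [w] is the value at the identity after applying [T_{w^-1}], which commutes with the
    right multiplication producing [z (delta v)]. For fixed [w], this exhibits the row of the matrix
    of [z] as a square-summable function of [v]. *)
Lemma right_invariant_coef v w :
  z (delta v) w = Tw (val (winv w)) (z (delta one)) (winv v).
Proof.
rewrite right_invariant_delta -{1}(winvK w) -Tw_at_one Tw_rTwC.
by rewrite rTw_at_one.
Qed.

End RightInvariant.

(** The constant is chosen before [z]: it depends only on [v], so it is uniform along
    approximations. *)
Lemma right_invariant_delta_le v : exists2 c, 0 <= c & forall z r,
  bounded_op z -> (forall t, commute_op z (rTs t)) ->
  l2_le (z (delta one)) r -> l2_le (z (delta v)) (c * r).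
Proof.
have /bounded_opP[_ [c c0 cP]] := bounded_rTw (val (winv v)).
by exists c => // z r bz zC zr; rewrite (right_invariant_delta zC) //; exact: cP.
Qed.

(** Cauchy-Schwarz between [f] and the row of [z] at [w], first on a finite part of [f]. The
    constant depends only on [w]. *)
Lemma right_invariant_at_le w : exists2 c, 0 <= c & forall z r f r',
  bounded_op z -> (forall t, commute_op z (rTs t)) ->
  l2_le (z (delta one)) r -> l2_le f r' -> cabs2 (z f w) <= c * r * r'.
Proof.
have /bounded_opP[_ [c c0 cP]] := bounded_Tw (val (winv w)).
exists (2 * c); first exact: mulr_ge0.
move=> z r f r' bz zC zr fr; apply/ler_addgt0Pr => e e0.
have [s us] := bounded_op_at w bz (l2_le_l2 fr) e0.
move=> /le_trans; apply; rewrite lerD2r -!mulrA ler_wpM2l //.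
rewrite lin_op_fin_part; last by case: bz.
under eq_bigr do rewrite (right_invariant_coef zC).
apply: le_trans (cabs2_sum_le _ _ _) _; rewrite mulrA mulrC.
apply: ler_pM; rewrite ?sumr_ge0 // => *; rewrite ?cabs2_ge0 //.
  have := cP _ _ zr; move=> /(l2_le_inj (@winv_inj L)); exact.
exact: fr.
Qed.

End Hecke.

(** * The radial algebra *)

Section CommutantSum.
Variables (R : realType) (L : nat).

Lemma commutant_sum (S : set (op R L)) (I : Type) (s : seq I) (A : I -> op R L) :
  (forall z, S z -> bounded_op z) -> (forall i, commutant S (A i)) ->
  commutant S (fun f w => \sum_(i <- s) A i f w).
Proof.
move=> bS cA; split; first by apply: bounded_sum => i; case: (cA i).
move=> z Sz f f2; have [lz _] := bS z Sz.
have [H _] := @lin_op_sum R L z I s (fun=> 1) (fun i => A i f) lz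
  (fun i => bounded_l2 (cA i).1 f2).
transitivity (z (fun w => \sum_(i <- s) 1 * A i f w)).
  rewrite H; apply/funext => w; apply: eq_bigr => i _.
  by rewrite mul1r (cA i).2.
by congr z; apply/funext => w; apply: eq_bigr => i _; rewrite mul1r.
Qed.

Lemma commutant0 (S : set (op R L)) :
  (forall z, S z -> bounded_op z) -> commutant S (fun _ _ => 0).
Proof.
move=> bS; split; first exact: bounded0.
by move=> z /bS[lz _] f _; rewrite lin_op0.
Qed.

Lemma commutant_id (S : set (op R L)) : commutant S id.
Proof. by split; first exact: bounded_id. Qed.

Lemma commutant_bounded (S : set (op R L)) z : commutant S z -> bounded_op z.
Proof. by case. Qed.

Lemma commutant_sym (S : set (op R L)) y z :
  bounded_op z -> commutant S y -> S z -> commutant [set y] z.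
Proof.
move=> bz [_ cy] Sz; split=> // _ -> f f2; symmetry; exact: cy.
Qed.

End CommutantSum.

Section SmulSums.
Variables (V : zmodType) (L : nat).
Implicit Types (w : seq 'I_L).

Lemma sum_smul_seq_cons (g : seq 'I_L -> V) a w :
  \sum_(s < L) g (smul_seq s (a :: w)) =
  g w + \sum_(s < L | s != a) g (s :: a :: w).
Proof.
rewrite (bigD1 a) //= smul_seq_cons eqxx; congr (_ + _).
by apply: eq_bigr => s sa; rewrite smul_seq_cons eq_sym (negPf sa).
Qed.

End SmulSums.

Section RadialAlgebra.
Variables (R : realType) (L : nat) (q : R).
Local Notation W := (Wgrp L).
Local Notation fct := (W -> R[i]).
Local Notation delta := (@delta R L).
Local Notation one := (wone L).
Local Notation h := (@hrad R L q).
Local Notation gens := [set Ts q s | s in [set: 'I_L]]%classic.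
Implicit Types (f g xi : fct) (r e : R) (x y : op R L).

Lemma gens_bounded z : gens z -> bounded_op z.
Proof. by move=> [s _ <-]; exact: bounded_Ts. Qed.

Lemma commutant_rTs t : commutant gens (rTs q t).
Proof.
by split; [exact: bounded_rTs|move=> _ [s _ <-] f _; rewrite Ts_rTsC].
Qed.

Definition rhrad : op R L := fun f => flip (h (flip f)).

Lemma commutant_rhrad : commutant gens rhrad.
Proof.
exact: (commutant_sum (index_enum 'I_L) gens_bounded commutant_rTs).
Qed.

Lemma commutant_gens_hrad y : commutant gens y -> commutant [set h]%classic y.
Proof.
move=> cy; have [by_ cyT] := cy; split=> // _ -> f f2; symmetry.
have H : commutant [set y]%classic h.
  apply: commutant_sum => [z ->//|s].
  by apply: commutant_sym cy _; [exact: bounded_Ts|exists s].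
by have [_ ->] := H.
Qed.

(** Puts the right multiplications among the operators with which every element of [radial q]
    commutes. *)
Lemma commutant_hrad_rTs t : commutant [set h]%classic (rTs q t).
Proof. exact/commutant_gens_hrad/commutant_rTs. Qed.

Lemma commutant_hrad_hrad : commutant [set h]%classic h.
Proof. by split; [exact: bounded_hrad|move=> _ ->]. Qed.

Lemma radial_hrad : radial q h.
Proof.
split; first exact: bounded_hrad.
by move=> y [_ cy] f f2; rewrite cy.
Qed.

Lemma radial_sub_VNq x : radial q x -> VNq q x.
Proof.
by move=> [bx cx]; split=> // y /commutant_gens_hrad; exact: cx.
Qed.

Lemma radial_commute x y : radial q x -> radial q y -> commute_op x y.
Proof.
move=> [_ cx] [by_ cy]; apply: cx; split=> // _ ->.
exact: cy commutant_hrad_hrad.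
Qed.

(** A nonempty word has exactly one left descent, its first letter, so [p] occurs once. *)
Lemma hradE f w : h f w = \sum_(s < L) f (smul s w) +
  (if val w == [::] then 0 else Complex (hp q) 0) * f w.
Proof.
rewrite /hrad /Ts big_split /= -mulr_suml; congr (_ + _ * _).
under eq_bigr do rewrite wlen_smul_lt.
rewrite -[sval w]/(val w); case: (val w) => [|a v] /=; first by rewrite big1.
by rewrite (bigD1 a) //= eqxx big1 ?addr0 // => s sa; case: (Some a =P Some s) sa => // -[->]; rewrite eqxx.
Qed.

Lemma rhrad_delta_one : rhrad (delta one) = h (delta one).
Proof.
apply/funext => w; apply: eq_bigr => s _.
rewrite -[LHS]/(flip (Ts q s (flip (delta one))) w).
rewrite flip_delta winv_one Ts_delta // flip_delta.
by congr delta; apply/val_inj.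
Qed.

(** By [hradE] the terms in [p] at [w] and at its inverse coincide, and they cancel. *)
Lemma sum_smul_comm xi : h xi = rhrad xi -> forall w,
  \sum_(s < L) xi (smul s w) = \sum_(s < L) xi (winv (smul s (winv w))).
Proof.
move=> E w.
have : h xi w = h (flip xi) (winv w) by rewrite [in LHS]E.
rewrite !hradE [flip xi (winv w)]/flip winvK => H.
have E0 : (val (winv w) == [::]) = (val w == [::]).
  by rewrite -!size_eq0 [size (val (winv w))]size_rev.
by move: H; rewrite E0 => /addIr.
Qed.

(** Spheres of radius larger than the longest word of [s] are disjoint from [s]. [P] stands for the
    real or the imaginary part. *)
Lemma l2_decay (P : R[i] -> R) xi e :
  (forall z, P z ^+ 2 <= cabs2 z) -> l2 xi -> 0 < e ->
  exists m0, forall m, (m0 <= m)%N ->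
    sphere_sum m (fun v => P (xi (insubd one v)) ^+ 2) <= e.
Proof.
move=> Pc xi2 e0; have [s us hs] := l2_off xi2 e0.
exists (\max_(w <- s) wlen w).+1 => m sm.
have ins (t : m.-tuple 'I_L) : reducedb t -> val (insubd one (val t)) = val t.
  by move=> rt; rewrite insubdK.
pose T := [seq insubd one (val t) | t : m.-tuple 'I_L <- index_enum _ & reducedb t].
apply: le_trans (hs T _).
  rewrite /T big_map big_filter /sphere_sum.
  apply: (@ler_sum R _ _ (fun t : m.-tuple 'I_L => reducedb t)) => t rt.
  rewrite /off ifN //; apply: contraL sm => ts.
  rewrite -ltnNge ltnS -{1}(size_tuple t) -(ins t rt).
  exact: (leq_bigmax_seq (F := @wlen L) _ ts isT).
rewrite /T map_inj_in_uniq ?filter_uniq ?index_enum_uniq //.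
move=> t t'; rewrite !mem_filter => /andP[rt _] /andP[rt' _] /(congr1 val).
by rewrite !ins // => /val_inj.
Qed.

Lemma commuting_vector_radial_part (P : R[i] -> R) xi : (1 < L)%N ->
  P 0 = 0 -> {morph P : z z' / z + z'} ->
  (forall z, P z ^+ 2 <= cabs2 z) -> l2 xi -> h xi = rhrad xi ->
  exists c : nat -> R, forall w, P (xi w) = c (wlen w).
Proof.
move=> L1 P0 PD Pc xi2 hxi; pose f w := P (xi (insubd one w)).
have fE w : f (val w) = P (xi w) by rewrite /f valKd.
have [||c Hc] := @commuting_radial R L f L1.
- move=> w rw w0; have := congr1 P (sum_smul_comm hxi (exist _ w rw)).
  rewrite !(big_morph P PD P0); under eq_bigr do rewrite -fE /=.
  under [RHS]eq_bigr do rewrite -fE /=.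
  have main (k : seq 'I_L -> R) (v : seq 'I_L) : v != [::] ->
      \sum_(s < L) k (smul_seq s v) = k (behead v) + left_ext k v.
    by case: v => // a v _; rewrite sum_smul_seq_cons left_ext_cons.
  rewrite main // => ->.
  by apply: (main (f \o rev)); rewrite -size_eq0 size_rev size_eq0.
- by move=> e e0; exact: (l2_decay Pc xi2 e0).
- by exists c => w; rewrite -fE Hc //; exact: valP.
Qed.

Lemma commuting_vector_radial xi : (1 < L)%N -> l2 xi -> h xi = rhrad xi ->
  exists c : nat -> R[i], forall w, xi w = c (wlen w).
Proof.
move=> L1 xi2 hxi.
have [|||c cE] := @commuting_vector_radial_part (@complex.Re R) xi L1 erefl (@ReD R).
- by move=> z; rewrite lerDl sqr_ge0.
- exact: xi2.
- exact: hxi.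
have [|||d dE] := @commuting_vector_radial_part (@complex.Im R) xi L1 erefl (@ImD R).
- by move=> z; rewrite lerDr sqr_ge0.
- exact: xi2.
- exact: hxi.
by exists (fun n => Complex (c n) (d n)) => w; rewrite -cE -dE; case: (xi w).
Qed.

(** * Approximation of radial vectors by polynomials in [h] *)

Definition sphere n : fct := fun w => (wlen w == n)%:R.

Lemma sum_sphere n w : \sum_(s < L) sphere n (smul s w) =
  if val w == [::] then L%:R * (n == 1)%:R
  else (wlen w == n.+1)%:R + L.-1%:R * ((wlen w).+1 == n)%:R.
Proof.
have E (v : W) s : sphere n (smul s v) = (size (smul_seq s (val v)) == n)%:R by [].
under eq_bigr do rewrite E.
rewrite /wlen; case: (val w) => [|a v] /=.
  by rewrite sumr_const card_ord eq_sym mulr_natl.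
rewrite (sum_smul_seq_cons (fun v => (size v == n)%:R)) eqSS /=.
by rewrite sumr_const cardC1 card_ord mulr_natl.
Qed.

Lemma hrad_sphere0 : h (sphere 0) = sphere 1.
Proof.
apply/funext => w; rewrite hradE sum_sphere /sphere -[val w == _]size_eq0 /=.
rewrite -/(wlen w); case: (wlen w) => [|m] /=; rewrite ?mulr0 ?mul0r ?addr0 //.
Qed.

(** The three-term recurrence [h 1_(n+1) = 1_(n+2) + p 1_(n+1) + k 1_n] for sphere indicators. The
    value [k = L] at [n = 0] reflects that the identity has [L] longer neighbours and any other word
    [L - 1]. *)
Lemma hrad_sphereS n (k := if n == 0%N then L else L.-1) :
  sphere n.+2 = (fun w => - Complex (hp q) 0 * sphere n.+1 w +
    (- k%:R * sphere n w + h (sphere n.+1) w)).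
Proof.
apply/funext => w; rewrite hradE sum_sphere /sphere -[val w == _]size_eq0 /=.
rewrite -/(wlen w); set p := Complex _ _.
rewrite {}/k; case: (wlen w) n => [|m] [|n]; rewrite /= ?eqSS; ring.
Qed.

Lemma radial_lin_comb a x y :
  radial q x -> radial q y -> radial q (lin_comb a x y).
Proof. exact: commutant_lin_comb (@commutant_bounded _ _ _). Qed.

Lemma radial_comp x y : radial q x -> radial q y -> radial q (x \o y).
Proof. exact: commutant_comp (@commutant_bounded _ _ _). Qed.

Lemma radial_sphere n : exists2 b, radial q b & b (delta one) = sphere n.
Proof.
(* The recurrence has order two, so two consecutive spheres are carried through the induction. *)
suff [] : (exists2 b, radial q b & b (delta one) = sphere n) /\
          (exists2 b, radial q b & b (delta one) = sphere n.+1) by [].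
elim: n => [|n [[b rb bE] [c rc cE]]].
  have E : delta one = sphere 0.
    by apply/funext => w; rewrite /delta /sphere -val_eqE -size_eq0.
  split; first by exists id => //; exact: commutant_id.
  by exists h; [exact: radial_hrad|rewrite E hrad_sphere0].
split; first by exists c.
rewrite hrad_sphereS; set k := (if _ then _ else _).
exists (lin_comb (- Complex (hp q) 0) c (lin_comb (- k%:R) b (h \o c))).
  apply: (radial_lin_comb _ rc); apply: (radial_lin_comb _ rb).
  exact: radial_comp radial_hrad rc.
by rewrite /lin_comb /= bE cE.
Qed.

Lemma radial_truncation (c : nat -> R[i]) N : exists2 b, radial q b &
  b (delta one) = (fun w => if (wlen w < N)%N then c (wlen w) else 0).
Proof.
elim: N => [|N [b rb bE]].
  by exists (fun _ _ => 0) => //; exact: commutant0 (@commutant_bounded _ _ _).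
have [d rd dE] := radial_sphere N.
exists (lin_comb (c N) d b); first exact: radial_lin_comb.
apply/funext => w; rewrite /lin_comb dE bE /sphere.
rewrite (_ : (wlen w < N.+1)%N = (wlen w == N) || (wlen w < N)%N); last first.
  by rewrite ltnS leq_eqVlt.
case: eqP => [->|_] /=; first by rewrite ltnn mulr1 addr0.
by rewrite mulr0 add0r.
Qed.

Lemma radial_approx xi (c : nat -> R[i]) e : l2 xi ->
  (forall w, xi w = c (wlen w)) -> 0 < e ->
  exists2 b, radial q b & l2_le (fun w => -1 * b (delta one) w + xi w) e.
Proof.
move=> xi2 xiE e0; have [s us hs] := l2_off xi2 e0.
have [b rb bE] := radial_truncation c (\max_(w <- s) wlen w).+1.
exists b => //; apply: l2_le_pw hs => w; rewrite bE /off ltnS.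
case: ifPn => [_|ws]; first by rewrite xiE mulN1r addNr cabs2_0 cabs2_ge0.
rewrite ifN ?mulr0 ?add0r //; apply: contra ws => ws.
exact: (leq_bigmax_seq (F := @wlen L) _ ws isT).
Qed.

Lemma VNq_hrad_commutant x : (1 < L)%N -> VNq q x -> commute_op x h -> radial q x.
Proof.
move=> L1 [bx cx] xh; split=> // y cy; have by_ := cy.1.
have xi2 : l2 (x (delta one)) by apply: bounded_l2 => //; exact: l2_delta.
(* [h x delta_e = x h delta_e], and [h delta_e] is also the right product of [delta_e] by [h], which
   [x] lets through. *)
have hxi : h (x (delta one)) = rhrad (x (delta one)).
  rewrite -xh; last exact: l2_delta.
  rewrite -(cx _ commutant_rhrad); last exact: l2_delta.
  by rewrite rhrad_delta_one.
have [c cE] := commuting_vector_radial L1 xi2 hxi.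
pose D := lin_comb (-1) (y \o x) (x \o y).
have bD : bounded_op D by apply: bounded_lin_comb; exact: bounded_comp.
suff D0 v : D (delta v) = (fun=> 0).
  move=> f f2; apply/funext => w; have := congr1 (fun g => g w) (bounded_op_eq0 bD D0 f2).
  by rewrite /D /lin_comb /= mulN1r addrC => /eqP; rewrite subr_eq0 => /eqP.
apply/funext => w; apply: cabs2_le0.
have [r yr] : exists r, l2_le (y (delta v)) r.
  by apply/l2P/bounded_l2 => //; exact: l2_delta.
have [_ [cy0 cy_ge0 cyP]] := (bounded_opP y).1 by_.
have [cv cv_ge0 cvP] := right_invariant_delta_le q v.
have [cw cw_ge0 cwP] := right_invariant_at_le q w.
have r0 := l2_le_ge0 yr.
(* The two summands come from [z (y (delta v))] and [y (z (delta v))], each doubled by [cabs2D]; the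
   1 makes [K] positive. *)
pose K := 2 * (cw * r) + 2 * (cy0 * cv) + 1.
have K0 : 0 < K by rewrite ltr_wpDl // addr_ge0 ?mulr_ge0.
apply/ler_addgt0Pl => e e0; rewrite addr0.
have eK : 0 < e / K by exact: divr_gt0.
have [b rb bE] := radial_approx xi2 cE eK.
pose z := lin_comb (-1) b x.
have [bb cb] := rb.
have bz : bounded_op z by exact: bounded_lin_comb.
(* [b] qualifies because [rTs q t] commutes with [h], and [x] because [rTs q t] commutes with all
   generators. *)
have zC t : commute_op z (rTs q t).
  have [_ H] : commutant [set rTs q t]%classic z.
    apply: commutant_lin_comb => [_ ->||]; first exact: bounded_rTs.
      by split=> // _ ->; apply: cb; exact: commutant_hrad_rTs.
    by split=> // _ ->; apply: cx; exact: commutant_rTs.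
  exact: H.
have v2 := @l2_delta R L v.
(* Since [b] commutes with [y], replacing [x] by [z = x - b] does not change the commutator with
   [y]. *)
have -> : D (delta v) w = z (y (delta v)) w + -1 * y (z (delta v)) w.
  rewrite /z /D /lin_comb /= by_.1; [|exact: bounded_l2|exact: bounded_l2].
  by rewrite (cb y cy) //; ring.
apply: le_trans (cabs2D _ _) _; rewrite cabs2M.
have -> : cabs2 (-1 : R[i]) = 1 by rewrite /cabs2 /= oppr0 expr0n sqrrN expr1n addr0.
have H1 := cwP z _ _ _ bz zC bE yr.
have H2 := l2_le_at w (cyP _ _ (cvP z _ bz zC bE)).
apply: (@le_trans _ _ (K * (e / K))); last by rewrite mulrC divfK // lt0r_neq0.
rewrite /K; lra.
Qed.

End RadialAlgebra.

Unset Implicit Arguments.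

Theorem theorem2p5 (R : realType) (L : nat) (q : R) :
  (3 <= L)%N -> 0 < q -> q <= 1 ->
  masa_in (@radial R L q) (@VNq R L q).
Proof.
move=> L3 _ _; split; first exact: radial_sub_VNq.
split; first exact: radial_commute.
move=> x Mx xB; apply: VNq_hrad_commutant => //; first exact: ltnW.
exact/xB/radial_hrad.
Qed.
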